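(* Let $\Bbbk$ be a field of characteristic zero and let $G$ be a group. (i) If $G$ is residually finite, then the group algebra $\Bbbk[G]$ is RFD. (ii) If $\Bbbk$ is algebraically closed and $G$ is conjugacy separable, then $\Bbbk[G]$ is trace-RFD.
   Context: A group is residually finite if every nontrivial element has nontrivial image in some finite quotient, and conjugacy separable if every pair of non-conjugate elements has non-conjugate images in some finite quotient. A finite-dimensional representation of a nonzero associative unital $\Bbbk$-algebra $C$ is a unital $\Bbbk$-algebra homomorphism $\rho\colon C\to\operatorname{End}_{\Bbbk}(V)$ with $V$ a nonzero finite-dimensional $\Bbbk$-vector space. The algebra $C$ is residually finite-dimensional (RFD) if for every nonzero $c\in C$ there is a finite-dimensional representation $\rho$ of $C$ with $\rho(c)\neq0$. The cocenter of $C$ is the vector space $C_{\natural}:=C/[C,C]$, where $[C,C]$ is the $\Bbbk$-linear span of all commutators $xy-yx$ with $x,y\in C$; the class of $c\in C$ is denoted $\overline c$. Each finite-dimensional representation $\rho$ induces a linear functional $\operatorname{tr}(-)(\rho)\colon C_{\natural}\to\Bbbk$, $\overline c\mapsto\operatorname{tr}(\rho(c))$. The algebra $C$ is trace residually finite-dimensional (trace-RFD) if it is RFD and, in addition, for every nonzero $\overline c\in C_{\natural}$ there is a finite-dimensional representation $\rho$ of $C$ with $\operatorname{tr}(\overline c)(\rho)\neq0$. *)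

(* Defs.v *)
From HB Require Import structures.
From mathcomp Require Import all_boot all_order all_fingroup all_algebra.
From mathcomp Require Import finmap generic_quotient ring_quotient.
From mathcomp Require Import monalg.
From mathcomp Require Import boolp.

Set Implicit Arguments.
Unset Strict Implicit.
Unset Printing Implicit Defensive.

Import GRing.Theory.

Local Open Scope ring_scope.
Local Open Scope quotient_scope.

(* A finite quotient of [G] is given by a surjective homomorphism [pi] onto a
   finite group [Q]; multiplicative maps between groups preserve 1. *)

Definition residually_finite (G : groupType) : Prop :=
  forall g : G, g <> 1%g ->
  exists (Q : finGroupType) (pi : {multiplicative G -> Q}),
    (forall q : Q, exists x : G, pi x = q) /\ pi g <> 1%g.

Definition conjugate (G : groupType) (g h : G) : Prop :=
  exists x : G, h = (g ^ x)%g.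

Definition conjugacy_separable (G : groupType) : Prop :=
  forall g h : G, ~ conjugate g h ->
  exists (Q : finGroupType) (pi : {multiplicative G -> Q}),
    (forall q : Q, exists x : G, pi x = q) /\ ~ conjugate (pi g) (pi h).

(* The library puts a ring structure on [{malg k[M]}] only for monoids [M]
   without nontrivial units, so the convolution product is redone here for
   groups, on the library's module [{malg k[G]}] of finitely supported
   functions; [<< g >>] is the basis vector of [g]. *)

Definition group_algebra (k : fieldType) (G : groupType) := {malg k[G]}.

HB.instance Definition _ (k : fieldType) (G : groupType) :=
  GRing.Lmodule.copy (group_algebra k G) {malg k[G]}.

Section GroupAlgebra.
Context (k : fieldType) (G : groupType).
Implicit Types (a b c : {malg k[G]}) (g h : G).

Definition ga_one : {malg k[G]} := << 1%g >>.

Definition ga_mul a b : {malg k[G]} :=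
  \sum_(g <- msupp a) \sum_(h <- msupp b) << a@_g * b@_h *g (g * h)%g >>.

Lemma ga_mulw (d1 d2 : {fset G}) a b :
  (msupp a `<=` d1)%fset -> (msupp b `<=` d2)%fset ->
  ga_mul a b = \sum_(g <- d1) \sum_(h <- d2) << a@_g * b@_h *g (g * h)%g >>.
Proof.
move=> le_d1 le_d2; rewrite /ga_mul (big_fset_incl _ le_d1) /=.
  apply/eq_bigr=> g _; apply/big_fset_incl => // h _ /mcoeff_outdom ->.
  by rewrite mulr0 monalgU0.
move=> g _ /mcoeff_outdom ag.
by rewrite big1 // => h _; rewrite ag mul0r monalgU0.
Qed.

Lemma ga_mulUU (x y : k) g h :
  ga_mul << x *g g >> << y *g h >> = << x * y *g (g * h)%g >>.
Proof. by rewrite (ga_mulw msuppU_le msuppU_le) !big_seq_fset1 !mcoeffUU. Qed.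

Lemma ga_mulDl : left_distributive ga_mul +%R.
Proof.
move=> a b c; have fc := fsubset_refl (msupp c).
rewrite [in RHS](ga_mulw (fsubsetUl _ (msupp b)) fc).
rewrite [in RHS](ga_mulw (fsubsetUr (msupp a) _) fc).
rewrite (ga_mulw (msuppD_le _ _) fc) -big_split /=; apply/eq_bigr=> g _.
rewrite -big_split /=; apply/eq_bigr=> h _.
by rewrite mcoeffD mulrDl monalgUD.
Qed.

Lemma ga_mulDr : right_distributive ga_mul +%R.
Proof.
move=> c a b; have fc := fsubset_refl (msupp c).
rewrite [in RHS](ga_mulw fc (fsubsetUl _ (msupp b))).
rewrite [in RHS](ga_mulw fc (fsubsetUr (msupp a) _)).
rewrite (ga_mulw fc (msuppD_le _ _)) -big_split /=; apply/eq_bigr=> g _.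
rewrite -big_split /=; apply/eq_bigr=> h _.
by rewrite mcoeffD mulrDr monalgUD.
Qed.

Lemma ga_mul0l : left_zero 0 ga_mul.
Proof. by move=> a; rewrite /ga_mul msupp0 big_seq_fset0. Qed.

Lemma ga_mul0r : right_zero 0 ga_mul.
Proof.
by move=> a; rewrite /ga_mul big1 // => g _; rewrite msupp0 big_seq_fset0.
Qed.

Lemma ga_mul_suml I (r : seq I) (F : I -> {malg k[G]}) b :
  ga_mul (\sum_(i <- r) F i) b = \sum_(i <- r) ga_mul (F i) b.
Proof. exact: (big_morph (ga_mul^~ b) (fun x y => ga_mulDl x y b) (ga_mul0l _)). Qed.

Lemma ga_mul_sumr I (r : seq I) (F : I -> {malg k[G]}) b :
  ga_mul b (\sum_(i <- r) F i) = \sum_(i <- r) ga_mul b (F i).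
Proof. exact: (big_morph (ga_mul b) (ga_mulDr b) (ga_mul0r _)). Qed.

Lemma ga_mul1l : left_id ga_one ga_mul.
Proof.
move=> a; rewrite [in LHS](monalgE a) ga_mul_sumr [RHS]monalgE.
by apply: eq_bigr => g _; rewrite ga_mulUU mul1r mul1g.
Qed.

Lemma ga_mul1r : right_id ga_one ga_mul.
Proof.
move=> a; rewrite [in LHS](monalgE a) ga_mul_suml [RHS]monalgE.
by apply: eq_bigr => g _; rewrite ga_mulUU mulr1 mulg1.
Qed.

Lemma ga_mulA : associative ga_mul.
Proof.
move=> a b c; rewrite (monalgE a) !ga_mul_suml; apply: eq_bigr => g _.
rewrite (monalgE b) ga_mul_suml !ga_mul_sumr ga_mul_suml.
apply: eq_bigr => h _; rewrite (monalgE c) !ga_mul_sumr.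
by apply: eq_bigr => i _; rewrite !ga_mulUU mulrA mulgA.
Qed.

Lemma ga_one_neq0 : ga_one != 0.
Proof. by apply/eqP/malgP=> /(_ 1%g) /eqP; rewrite mcoeffUU mcoeff0 oner_eq0. Qed.

HB.instance Definition _ := GRing.Zmodule_isNzRing.Build (group_algebra k G)
  ga_mulA ga_mul1l ga_mul1r ga_mulDl ga_mulDr ga_one_neq0.

Lemma ga_scaleU (x y : k) g : x *: (<< y *g g >> : {malg k[G]}) = << x * y *g g >>.
Proof. by apply/malgP=> h; rewrite mcoeffZ !mcoeffU mulrnAr. Qed.

Lemma ga_scaleAl (x : k) (a b : group_algebra k G) : x *: (a * b) = (x *: a) * b.
Proof.
change (x *: (ga_mul a b) = ga_mul (x *: (a : {malg k[G]})) b).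
rewrite (monalgE a) ga_mul_suml !scaler_sumr ga_mul_suml; apply: eq_bigr => g _.
rewrite (monalgE b) !ga_mul_sumr scaler_sumr; apply: eq_bigr => h _.
by rewrite !(ga_scaleU, ga_mulUU) mulrA.
Qed.

HB.instance Definition _ :=
  GRing.Lmodule_isLalgebra.Build k (group_algebra k G) ga_scaleAl.

Lemma ga_scaleAr (x : k) (a b : group_algebra k G) : x *: (a * b) = a * (x *: b).
Proof.
change (x *: (ga_mul a b) = ga_mul a (x *: (b : {malg k[G]}))).
rewrite (monalgE b) ga_mul_sumr !scaler_sumr ga_mul_sumr; apply: eq_bigr => h _.
rewrite (monalgE a) !ga_mul_suml scaler_sumr; apply: eq_bigr => g _.
by rewrite !(ga_scaleU, ga_mulUU) mulrCA.
Qed.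

HB.instance Definition _ :=
  GRing.Lalgebra_isAlgebra.Build k (group_algebra k G) ga_scaleAr.

Lemma group_algebra_mulUU (g h : G) :
  (<< g >> : group_algebra k G) * << h >> = << (g * h)%g >>.
Proof. by have := ga_mulUU 1 1 g h; rewrite mulr1. Qed.

Lemma group_algebra_oneE : (1 : group_algebra k G) = << 1%g >>.
Proof. by []. Qed.

End GroupAlgebra.

Section Representations.
Context (k : fieldType).

(* [\o] is used rather than a ring structure on ['End(V)], whose product in
   the library is composition in the opposite order. *)
Record fd_rep (C : algType k) := FdRep {
  rep_space : vectType k;
  rep_space_neq0 : \dim {: rep_space} != 0%N;
  rep_map :> {linear C -> 'End(rep_space)};
  rep_map1 : rep_map 1 = \1%VF;
  rep_mapM : forall x y : C, rep_map (x * y) = (rep_map x \o rep_map y)%VF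
}.

Definition lftrace (V : vectType k) (f : 'End(V)) : k :=
  \tr (passmx.mxof (vbasis {:V}) (vbasis {:V}) f).

Lemma lftrace_is_linear (V : vectType k) : scalar (@lftrace V).
Proof. by move=> a f g; rewrite /lftrace passmx.mxof_linear mxtraceD mxtraceZ. Qed.

HB.instance Definition _ (V : vectType k) :=
  GRing.isLinear.Build k 'End(V) k *%R (@lftrace V) (@lftrace_is_linear V).

Lemma lftraceC (V : vectType k) (f g : 'End(V)) :
  lftrace (f \o g)%VF = lftrace (g \o f)%VF.
Proof.
by rewrite /lftrace !(passmx.mxof_comp _ _ (vbasisP _)) mxtrace_mulC.
Qed.

Lemma lftrace_basis (V : vectType k) (e : (\dim {:V}).-tuple V) (f : 'End(V)) :
  basis_of {:V} e -> lftrace f = \tr (passmx.mxof e e f).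
Proof.
move=> eP; rewrite -{2}[f]comp_lfun1r (passmx.mxof_comp _ _ (vbasisP _)).
by rewrite mxtrace_mulC -(passmx.mxof_comp _ _ eP) comp_lfun1l.
Qed.

Definition RFD (C : algType k) : Prop :=
  forall c : C, c != 0 -> exists rho : fd_rep C, rho c != 0.

End Representations.

Section Cocenter.
Context (k : fieldType) (C : algType k).

Definition commutator_span : {pred C} := fun c =>
  `[< exists s : seq (k * (C * C)),
        c = \sum_(t <- s) t.1 *: (t.2.1 * t.2.2 - t.2.2 * t.2.1) >].

Lemma commutator_spanP (c : C) :
  reflect (exists s : seq (k * (C * C)),
             c = \sum_(t <- s) t.1 *: (t.2.1 * t.2.2 - t.2.2 * t.2.1))
          (c \in commutator_span).
Proof. exact: asboolP. Qed.

Lemma commutator_span_submod_closed : submod_closed commutator_span.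
Proof.
split; first by apply/commutator_spanP; exists [::]; rewrite big_nil.
move=> a _ _ /commutator_spanP [s ->] /commutator_spanP [t ->].
apply/commutator_spanP; exists ([seq (a * u.1, u.2) | u <- s] ++ t).
rewrite big_cat big_map /= scaler_sumr; congr (_ + _).
by apply: eq_bigr => u _; rewrite scalerA.
Qed.

HB.instance Definition _ :=
  GRing.isSubmodClosed.Build k C commutator_span commutator_span_submod_closed.

Definition cocenter : Type := {ideal_quot commutator_span}.

HB.instance Definition _ := GRing.Zmodule.on cocenter.

Definition cocenter_class (c : C) : cocenter := \pi c.

Lemma cocenter_class_eq (x y : C) :
  (cocenter_class x == cocenter_class y) = (x - y \in commutator_span).
Proof. by rewrite /cocenter_class -Quotient.idealrBE. Qed.

Lemma cocenter_class_repr (q : cocenter) : cocenter_class (repr q) = q.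
Proof. exact: reprK. Qed.

Lemma cocenter_classD : {morph cocenter_class : x y / x + y}.
Proof. by move=> x y; rewrite /cocenter_class raddfD. Qed.

Lemma cocenter_class0 : cocenter_class 0 = 0.
Proof. exact: raddf0. Qed.

Lemma cocenter_class_eq0 (x : C) :
  (cocenter_class x == 0) = (x \in commutator_span).
Proof. by rewrite -cocenter_class0 cocenter_class_eq subr0. Qed.

Definition cocenter_scale (a : k) (q : cocenter) : cocenter :=
  cocenter_class (a *: repr q).

Lemma cocenter_scaleE (a : k) (x : C) :
  cocenter_scale a (cocenter_class x) = cocenter_class (a *: x).
Proof.
apply/eqP; rewrite /cocenter_scale cocenter_class_eq -scalerBr rpredZ //.
by rewrite -cocenter_class_eq cocenter_class_repr.
Qed.

Lemma cocenter_scaleA (a b : k) q :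
  cocenter_scale a (cocenter_scale b q) = cocenter_scale (a * b) q.
Proof. by rewrite -[q]cocenter_class_repr !cocenter_scaleE scalerA. Qed.

Lemma cocenter_scale1 : left_id 1 cocenter_scale.
Proof. by move=> q; rewrite -[q]cocenter_class_repr cocenter_scaleE scale1r. Qed.

Lemma cocenter_scaleDr : right_distributive cocenter_scale +%R.
Proof.
move=> a p q; rewrite -[p]cocenter_class_repr -[q]cocenter_class_repr.
by rewrite -cocenter_classD !cocenter_scaleE scalerDr cocenter_classD.
Qed.

Lemma cocenter_scaleDl q : {morph cocenter_scale^~ q : a b / a + b}.
Proof.
move=> a b; rewrite -[q]cocenter_class_repr.
by rewrite !cocenter_scaleE scalerDl cocenter_classD.
Qed.

HB.instance Definition _ := GRing.Zmodule_isLmodule.Build k cocenter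
  cocenter_scaleA cocenter_scale1 cocenter_scaleDr cocenter_scaleDl.

Definition cocenter_trace (rho : fd_rep C) (q : cocenter) : k :=
  lftrace (rho (repr q)).

Lemma cocenter_traceE (rho : fd_rep C) (c : C) :
  cocenter_trace rho (cocenter_class c) = lftrace (rho c).
Proof.
apply/eqP; rewrite -subr_eq0 /cocenter_trace -!linearB /=.
set d := _ - c; have /commutator_spanP [s ->] : d \in commutator_span.
  by rewrite -cocenter_class_eq cocenter_class_repr.
rewrite !linear_sum big1 // => t _.
by rewrite !linearZ /= !linearB /= !rep_mapM lftraceC subrr mulr0.
Qed.

Lemma cocenter_trace_is_linear (rho : fd_rep C) : scalar (cocenter_trace rho).
Proof.
move=> a p q; rewrite -[p]cocenter_class_repr -[q]cocenter_class_repr.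
rewrite -[a *: _]/(cocenter_scale a _) cocenter_scaleE -cocenter_classD.
by rewrite !cocenter_traceE !linearP.
Qed.

HB.instance Definition _ (rho : fd_rep C) :=
  GRing.isLinear.Build k cocenter k *%R (cocenter_trace rho)
    (cocenter_trace_is_linear rho).

Definition trace_RFD : Prop :=
  RFD C /\
  forall q : cocenter, q != 0 ->
    exists rho : fd_rep C, cocenter_trace rho q != 0.

End Cocenter.

(* Main.v *)
Require Import Defs.
From HB Require Import structures.
From mathcomp Require Import all_boot all_fingroup all_algebra.
From mathcomp Require Import closed_field mxrepresentation.
From mathcomp Require Import finmap monalg boolp.

(** Both parts go through the regular representation [R] of one finite quotient
    [pi : G -> Q]. As [tr (R q)] is [#|Q|] for [q = 1] and [0] otherwise,
    [tr (R (pi c) * R (pi g0)^-1)] is [#|Q|] times the sum of the coefficients of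
    [c] over the fibre of [pi g0]. If [pi] separates [g0] from the rest of the
    support of [c], this is nonzero in characteristic zero, which gives (i).
    For (ii), [c] is outside the commutator span exactly when its coefficients
    have nonzero sum over some conjugacy class, say that of [g0]; choose [pi]
    so that no other class in the support meets it in [Q]. Let [D] be the sum
    over [x : Q] of the conjugates of [R (pi c)] by [R x]. Then [D] commutes with
    [R Q] and [tr (D * R (pi g0)^-1) != 0], so [D] is not nilpotent and has an
    eigenvalue [l != 0]. On the subrepresentation [V := ker (D - l)], conjugation
    invariance of the trace gives [#|Q| * tr_V c = l * dim V != 0]. *)

Set Implicit Arguments.
Unset Strict Implicit.
Unset Printing Implicit Defensive.

Import GRing.Theory passmx.
Local Open Scope ring_scope.

(** * Eigenvalues and nilpotency over an algebraically closed field *)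

Lemma closed_field_poly_split (k : fieldType) (p : {poly k}) :
  GRing.closed_field_axiom k ->
  exists r : seq k, p = lead_coef p *: \prod_(z <- r) ('X - z%:P).
Proof.
case: k p => T cT p closed_k; pose kF : fieldType := GRing.Field.Pack cT.
pose K : closedFieldType := HB.pack T kF (Field_isAlgClosed.Build kF closed_k).
by have [r Dr] := @closed_field_poly_normal K p; exists r.
Qed.

Section ClosedField.
Variables (k : fieldType) (closed_k : GRing.closed_field_axiom k).

Lemma char_poly_eq_Xn n (A : 'M[k]_n) :
  (forall l, eigenvalue A l -> l = 0) -> char_poly A = 'X^n.
Proof.
move=> A0; have [r Dr] := closed_field_poly_split (char_poly A) closed_k.
have /monicP mon := char_poly_monic A.
have {mon}Dr : char_poly A = \prod_(z <- r) ('X - z%:P).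
  by rewrite {1}Dr [X in X *: _]mon scale1r.
have r0 z : z \in r -> z = 0.
  by move=> rz; apply: A0; rewrite eigenvalue_root_char Dr root_prod_XsubC.
have EX : char_poly A = 'X^(size r).
  rewrite Dr big_seq (eq_bigr (fun=> 'X)).
    by rewrite -big_seq big_const_seq count_predT -Monoid.iteropE.
  by move=> z /r0 ->; rewrite subr0.
by have := size_char_poly A; rewrite EX size_polyXn => -[->].
Qed.

(** If all eigenvalues of [A] were zero, Cayley-Hamilton would make [A] nilpotent, hence also
    [A *m B] by commutation, and a nilpotent matrix has trace zero. *)
Lemma nonzero_eigenvalue n (A B : 'M[k]_n) :
  A *m B = B *m A -> \tr (A *m B) != 0 -> exists2 l, l != 0 & eigenvalue A l.
Proof.
case: n A B => [|n] A B cAB trAB; first by rewrite /mxtrace big_ord0 eqxx in trAB.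
apply: contrapT => noA.
have nilA : A ^+ n.+1 = 0.
  rewrite -[RHS](Cayley_Hamilton A) char_poly_eq_Xn ?rmorphXn /= ?horner_mx_X //.
  by move=> l Al; apply/eqP/negPn/negP => l0; apply: noA; exists l.
have nilAB : (A *m B) ^+ n.+1 = 0.
  have cAB' : GRing.comm A B := cAB.
  by rewrite -[A *m B]/(A * B) exprMn_comm // nilA mul0r.
have vX l (v : 'rV_n.+1) m :
    v *m (A *m B) = l *: v -> v *m (A *m B) ^+ m = l ^+ m *: v.
  move=> vl; elim: m => [|m IHm]; first by rewrite expr0 mulmx1 scale1r.
  by rewrite exprSr -[_ * _]/(_ *m _) mulmxA IHm -scalemxAl vl scalerA exprSr.
have eAB : char_poly (A *m B) = 'X^(n.+1).
  apply: char_poly_eq_Xn => l /eigenvalueP [v vl v0].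
  have := vX l v n.+1 vl; rewrite nilAB mulmx0 => /esym/eqP.
  by rewrite scaler_eq0 (negPf v0) orbF expf_eq0 => /andP [_ /eqP].
(* The trace is minus the second-highest coefficient of the characteristic polynomial, here
   ['X^(n.+1)]. *)
have := char_poly_trace (A *m B) isT.
by rewrite eAB coefXn /= ltn_eqF // => /esym/eqP; rewrite oppr_eq0 (negPf trAB).
Qed.

End ClosedField.

(** * Traces of endomorphisms and of the regular representation *)

Lemma lftrace_mulmx (k : fieldType) n (M : 'M[k]_n) (f : 'End('cV[k]_n)) :
  (forall v, f v = M *m v) -> lftrace f = \tr M.
Proof.
move=> fE; have eP := vbasisP {:'cV[k]_n}.
rewrite /lftrace; set e := vbasis _ in eP *.
(* [mxof] acts on row vectors, so [M] enters as [M^T]; [B] and [C] translate between transposed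
   columns and coordinates in [e]. *)
pose B := lin1_mx (rVof e \o @trmx k 1 n).
pose C := lin1_mx (@trmx k n 1 \o vecof e).
have CB : B *m C = 1%:M.
  apply/row_matrixP => i; rewrite !rowE mulmxA !mul_rV_lin1 /=.
  by rewrite (rVofK eP) trmxK mulmx1.
have -> : mxof e e f = C *m (M^T *m B).
  apply/row_matrixP => i; rewrite !rowE 2!mulmxA !mul_rV_lin1 /=.
  by rewrite fE trmx_mul !trmxK.
by rewrite mxtrace_mulC -mulmxA CB mulmx1 mxtrace_tr.
Qed.

(** Right translation by [x] permutes the basis of group elements and has no fixed point unless [x]
    is trivial. *)
Lemma mxtrace_regular (k : fieldType) (Q : finGroupType) (x : Q) :
  \tr (regular_repr k [set: Q]%G x) = #|Q|%:R *+ (x == 1%g).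
Proof.
rewrite /mxtrace (eq_bigr (fun=> (x == 1%g)%:R)) => [|i _].
  rewrite sumr_const card_ord (cardsT Q : gcard [set: Q]%G = _).
  by case: (_ == _); rewrite ?mul0rn.
rewrite !mxE eqxx /= -[i in i == _]gring_valK.
rewrite (can_in_eq (gring_indexK (G := [set: Q]%G))) ?inE //.
by rewrite -{1}[enum_val i]mulg1 (inj_eq (mulgI _)) eq_sym.
Qed.

(** * Separating finitely many elements in one finite group *)

Section Morphisms.
Variables (G : groupType) (Q : groupType) (pi : {multiplicative G -> Q}).

Lemma multiplicative1 : pi 1%g = 1%g.
Proof. by apply: (mulgI (pi 1%g)); rewrite -gmulfM !mulg1. Qed.

Lemma multiplicativeJ x y : pi (x ^ y)%g = (pi x ^ pi y)%g.
Proof. by apply: (mulgI (pi y)); rewrite -gmulfM -!conjgC gmulfM. Qed.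

End Morphisms.

Section PairMorphism.
Variables (G : groupType) (Q1 Q2 : finGroupType).
Variables (f1 : {multiplicative G -> Q1}) (f2 : {multiplicative G -> Q2}).

Definition pair_morphism (g : G) : Q1 * Q2 := (f1 g, f2 g).

Lemma pair_morphismM : {morph pair_morphism : x y / (x * y)%g}.
Proof. by move=> x y; rewrite /pair_morphism !gmulfM. Qed.

HB.instance Definition _ :=
  monoid.isMultiplicative.Build G (Q1 * Q2)%type pair_morphism pair_morphismM.

End PairMorphism.

(** The product of the separating quotients works, since [R] passes to both components. Equality
    serves for (i), conjugacy for (ii). A paired map may fail to be onto, so only a homomorphism is
    claimed. *)
Lemma joint_quotient (G : groupType) (R : forall Q : finGroupType, Q -> Q -> Prop)
    (R1 : forall (Q1 Q2 : finGroupType) (a b : Q1 * Q2), R _ a b -> R _ a.1 b.1)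
    (R2 : forall (Q1 Q2 : finGroupType) (a b : Q1 * Q2), R _ a b -> R _ a.2 b.2)
    (g0 : G) (s : seq G) :
  (forall g, g \in s -> exists (Q : finGroupType) (pi : {multiplicative G -> Q}),
     ~ R Q (pi g) (pi g0)) ->
  exists (Q : finGroupType) (pi : {multiplicative G -> Q}),
    forall g, g \in s -> ~ R Q (pi g) (pi g0).
Proof.
elim: s => [|g s IHs] sepR; first by exists {perm 'I_0}, (one_fun _).
have [|Q1 [f1 sep1]] := IHs; first by move=> h hs; apply: sepR; rewrite inE hs orbT.
have [|Q2 [f2 sep2]] := sepR g; first exact: mem_head.
exists (Q1 * Q2)%type, (pair_morphism f1 f2) => h.
by rewrite inE => /orP [/eqP -> /R2 //|/sep1 nR /R1].
Qed.

(** * Representations of the group algebra pulled back along [pi] *)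

Section LinearExtension.
Variables (k : fieldType) (G : groupType) (V : lmodType k) (f : G -> V).

Definition malg_ext (c : group_algebra k G) : V :=
  \sum_(g <- msupp (c : {malg k[G]})) (c : {malg k[G]})@_g *: f g.

Lemma malg_extw (d : {fset G}) (c : {malg k[G]}) :
  (msupp c `<=` d)%fset -> malg_ext c = \sum_(g <- d) c@_g *: f g.
Proof.
by move=> led; apply: big_fset_incl => // g _ /mcoeff_outdom ->; rewrite scale0r.
Qed.

Lemma malg_ext_is_linear : linear malg_ext.
Proof.
move=> x a b.
pose d := (msupp (x *: a + b : {malg k[G]}) `|`
           (msupp (a : {malg k[G]}) `|` msupp (b : {malg k[G]})))%fset.
rewrite (@malg_extw d (x *: a + b)) ?fsubsetUl //.
rewrite (@malg_extw d a) ?fsubsetU ?fsubset_refl ?orbT //.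
rewrite (@malg_extw d b) ?fsubsetU ?fsubset_refl ?orbT //.
rewrite scaler_sumr -big_split /=; apply: eq_bigr => g _.
by rewrite mcoeffD mcoeffZ scalerDl scalerA.
Qed.

HB.instance Definition _ :=
  GRing.isLinear.Build k (group_algebra k G) V *:%R malg_ext malg_ext_is_linear.

Lemma malg_extU (x : k) g : malg_ext << x *g g >> = x *: f g.
Proof. by rewrite (malg_extw msuppU_le) big_seq_fset1 mcoeffUU. Qed.

End LinearExtension.

Lemma malg_extM (k : fieldType) (G : groupType) n (f : G -> 'M[k]_n)
    (a b : group_algebra k G) :
  {morph f : x y / (x * y)%g >-> x *m y} ->
  malg_ext f (a * b) = malg_ext f a *m malg_ext f b.
Proof.
move=> fM; rewrite (monalgE a) (monalgE b).
rewrite (mulr_suml (R := group_algebra k G)) !(linear_sum (malg_ext f)).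
rewrite mulmx_suml.
apply: eq_bigr => g _.
rewrite (mulr_sumr (R := group_algebra k G)) !linear_sum /=.
apply: eq_bigr => h _.
by rewrite [_ * _]ga_mulUU !malg_extU fM -scalemxAl -scalemxAr scalerA.
Qed.

Section PullbackRep.
Variables (k : fieldType) (G : groupType) (Q : finGroupType).
Variables (pi : {multiplicative G -> Q}) (n : nat).
Variables (rG : mx_representation k [set: Q]%G n) (n_gt0 : (0 < n)%N).

Definition pullback_mx : group_algebra k G -> 'M[k]_n := malg_ext (rG \o pi).

(** Left multiplication on columns turns matrix products into [\o] in the order that [fd_rep]
    demands. *)
Definition pullback_lfun (c : group_algebra k G) : 'End('cV[k]_n) :=
  linfun (mulmx (pullback_mx c)).

Lemma pullback_lfunE c v : pullback_lfun c v = pullback_mx c *m v.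
Proof. by rewrite lfunE. Qed.

Lemma pullback_lfun_is_linear : linear pullback_lfun.
Proof.
move=> x a b; apply/lfunP => v; rewrite add_lfunE scale_lfunE !pullback_lfunE.
by rewrite /pullback_mx linearP mulmxDl -scalemxAl.
Qed.

HB.instance Definition _ :=
  GRing.isLinear.Build k (group_algebra k G) 'End('cV[k]_n) *:%R pullback_lfun
    pullback_lfun_is_linear.

Lemma pullback_lfun1 : pullback_lfun 1 = \1%VF.
Proof.
apply/lfunP => v; rewrite pullback_lfunE id_lfunE /pullback_mx.
by rewrite group_algebra_oneE malg_extU /= multiplicative1 repr_mx1 scale1r mul1mx.
Qed.

Lemma pullback_lfunM a b :
  pullback_lfun (a * b) = (pullback_lfun a \o pullback_lfun b)%VF.
Proof.
apply/lfunP => v; rewrite comp_lfunE !pullback_lfunE mulmxA /pullback_mx malg_extM //.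
by move=> x y /=; rewrite gmulfM repr_mxM ?inE.
Qed.

Lemma pullback_space_neq0 : \dim {: 'cV[k]_n} != 0%N.
Proof. by rewrite dimvf dim_matrix mulr1 -lt0n. Qed.

Definition pullback_rep : fd_rep (group_algebra k G) :=
  FdRep pullback_space_neq0 pullback_lfun1 pullback_lfunM.

Lemma lftrace_pullback c : lftrace (pullback_rep c) = \tr (pullback_mx c).
Proof. exact/lftrace_mulmx/pullback_lfunE. Qed.

End PullbackRep.

(** The factor [y^-1] moves the fibre over [y] to the identity, the only element with nonzero
    regular trace. *)
Lemma mxtrace_pullback_regular (k : fieldType) (G : groupType) (Q : finGroupType)
    (pi : {multiplicative G -> Q}) (c : group_algebra k G) (y : Q) :
  \tr (pullback_mx pi (regular_repr k [set: Q]%G) c *m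
       regular_repr k [set: Q]%G y^-1%g)
    = #|Q|%:R * \sum_(g <- msupp (c : {malg k[G]}) | pi g == y) (c : {malg k[G]})@_g.
Proof.
rewrite mulmx_suml raddf_sum /= mulr_sumr [RHS]big_mkcond; apply: eq_bigr => g _.
rewrite -scalemxAl mxtraceZ -repr_mxM ?inE // mxtrace_regular mulrC.
by rewrite -eq_mulgV1; case: eqP; rewrite ?mulr0n ?mul0r.
Qed.

(** * Part (i): residual finiteness *)

Lemma residually_finite_RFD (k : fieldType) (G : groupType) :
  [pchar k] =i pred0 -> residually_finite G -> RFD (group_algebra k G).
Proof.
move=> char0 rfG c c0.
have [g0 g0c] : exists g0, (c : {malg k[G]})@_g0 != 0.
  apply: contrapT => nc; move/eqP: c0; apply; apply/malgP => g.
  by rewrite mcoeff0; apply/eqP/negPn/negP => cg; apply: nc; exists g.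
have [|||Q [pi sep]] := @joint_quotient G (fun Q => @eq Q) _ _ g0
    [seq g <- msupp (c : {malg k[G]}) | g != g0].
- by move=> Q1 Q2 a b ->.
- by move=> Q1 Q2 a b ->.
- move=> g; rewrite mem_filter => /andP [/eqP gg0 _].
  (* Separating [g] from [g0] amounts to keeping [g * g0^-1] nontrivial. *)
  have [gg|Q [pi [_ sep]]] := rfG (g * g0^-1)%g; first by apply: gg0; apply/divg1_eq.
  exists Q, pi => pigg0; apply: sep.
  by rewrite gmulfM pigg0 -gmulfM mulgV multiplicative1.
exists (pullback_rep pi (regular_repr k [set: Q]%G) (cardG_gt0 _)).
apply/eqP => rc0.
have M0 : pullback_mx pi (regular_repr k [set: Q]%G) c = 0.
  apply/matrixP => i j; rewrite mxE.
  have := congr1 (fun f : 'End('cV[k]_ _) => f (delta_mx j 0) i 0) rc0.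
  by rewrite [in LHS]pullback_lfunE -colE zero_lfunE !mxE.
have := mxtrace_pullback_regular pi c (pi g0).
(* Within the support [g0] is alone in its fibre, so the fibre sum is the coefficient at [g0]. *)
rewrite M0 mul0mx mxtrace0 big_seq_cond (eq_bigl (pred1 g0)).
  rewrite -big_filter filter_pred1_uniq ?fset_uniq -?mcoeff_neq0 //.
  rewrite big_seq1 => /esym/eqP; rewrite mulf_eq0 (negPf g0c) orbF.
  rewrite (proj1 (pcharf0P k) char0) -cardsT -leqn0 leqNgt.
  by rewrite (cardG_gt0 [set: Q]%G).
move=> g /=; have [->|gg0] := eqVneq g g0; first by rewrite eqxx -mcoeff_neq0 g0c.
apply/andP => -[gc /eqP]; apply: sep.
by rewrite mem_filter gg0.
Qed.

(** * Class sums and the commutator span *)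

Section Cocenter.
Variables (k : fieldType) (G : groupType).

Lemma commutator_span_conj (x : k) (g y : G) :
  (<< x *g g >> - << x *g (g ^ y)%g >> : group_algebra k G)
    \in @commutator_span k (group_algebra k G).
Proof.
(* With [h = y^-1 * g] one has [g = y * h] and [g ^ y = h * y]. *)
apply/commutator_spanP; exists [:: (x, (<< y >>, << (y^-1 * g)%g >>))].
rewrite big_seq1 /= !group_algebra_mulUU mulVKg -mulgA scalerBr.
by rewrite ![x *: _]ga_scaleU mulr1.
Qed.

Lemma conjugate_refl (g : G) : Defs.conjugate g g.
Proof. by exists 1%g; rewrite conjg1. Qed.

Lemma conjugate_sym (g h : G) : Defs.conjugate g h -> Defs.conjugate h g.
Proof. by case=> x ->; exists x^-1%g; rewrite conjgK. Qed.

Lemma conjugate_trans (g h i : G) :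
  Defs.conjugate g h -> Defs.conjugate h i -> Defs.conjugate g i.
Proof. by case=> x -> [y ->]; exists (x * y)%g; rewrite conjgM. Qed.

(** Modulo commutators every [g] may be replaced by a chosen representative of its class; the
    resulting coefficients are class sums, all zero. *)
Lemma class_sums_commutator_span (c : group_algebra k G) :
  (forall g0, \sum_(g <- msupp (c : {malg k[G]}) | `[< Defs.conjugate g g0 >])
     (c : {malg k[G]})@_g = 0) ->
  c \in @commutator_span k (group_algebra k G).
Proof.
move=> sum0; pose r (g : G) := choose (fun h => `[< Defs.conjugate g h >]) g.
have rP g : Defs.conjugate g (r g).
  apply/asboolP/(@chooseP _ (fun h => `[< Defs.conjugate g h >])).
  exact/asboolP/conjugate_refl.
have r_conj g h : Defs.conjugate g h -> r g = r h.
  move=> cgh; rewrite /r (@eq_choose _ _ (fun i => `[< Defs.conjugate h i >])).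
    (* Both default arguments satisfy the predicate, so [choose] returns the same element from
       either. *)
    by apply: choose_id; apply/asboolP; [apply: conjugate_sym|apply: conjugate_refl].
  move=> i; apply/asbool_equiv_eq; split; apply: conjugate_trans => //.
  exact: conjugate_sym.
have -> : c = \sum_(g <- msupp (c : {malg k[G]}))
    (<< (c : {malg k[G]})@_g *g g >> - << (c : {malg k[G]})@_g *g r g >>).
  rewrite big_split sumrN /= -[X in X + _ ]monalgE -[LHS]addr0; congr (_ + _).
  apply/esym/eqP; rewrite oppr_eq0; apply/eqP/malgP => h; rewrite mcoeff0 raddf_sum /=.
  under eq_bigr do rewrite mcoeffU mulrb.
  rewrite -big_mkcond /=.
  (* If [h] is not a chosen representative, no term lands on it; otherwise the terms are those of
     its class. *)
  have [/eqP rh|rh] := boolP (r h == h); last first.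
    rewrite big1 // => g /eqP rg; case/eqP: rh.
    by rewrite -{1}rg -(r_conj _ _ (rP g)).
  rewrite -[RHS](sum0 h); apply: eq_bigl => g; apply/eqP/asboolP => [<-|/r_conj ->] //.
apply: rpred_sum => g _; have [x ->] := rP g; exact: commutator_span_conj.
Qed.

End Cocenter.

(** * Summing over the conjugates by [Q] *)

Section ClassAverage.
Variables (k : fieldType) (G : groupType) (Q : finGroupType).
Variables (pi : {multiplicative G -> Q}) (c : group_algebra k G).

Definition conjugation_sum n (rG : mx_representation k [set: Q]%G n) : 'M[k]_n :=
  \sum_(x : Q) rG x^-1%g *m pullback_mx pi rG c *m rG x.

Lemma mxtrace_conjugation_sum n (rG : mx_representation k [set: Q]%G n) :
  \tr (conjugation_sum rG) = #|Q|%:R * \tr (pullback_mx pi rG c).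
Proof.
rewrite raddf_sum /= (eq_bigr (fun=> \tr (pullback_mx pi rG c))).
  by rewrite sumr_const mulr_natl.
by move=> x _; rewrite mxtrace_mulC mulmxA -repr_mxM ?inE // mulgV repr_mx1 mul1mx.
Qed.

Lemma conjugation_sum_centg n (rG : mx_representation k [set: Q]%G n) :
  centgmx rG (conjugation_sum rG).
Proof.
apply/centgmxP => y _; rewrite mulmx_suml mulmx_sumr.
rewrite [RHS](reindex_inj (mulIg y)); apply: eq_bigr => x _.
rewrite invMg !repr_mxM ?inE // !mulmxA -repr_mxM ?inE // mulgV repr_mx1 mul1mx.
by [].
Qed.

(** The sum is built from group actions by products and linear combinations, so it restricts to
    submodules; this later identifies it with a scalar on an eigenspace. *)
Lemma conjugation_sum_submod n (rG : mx_representation k [set: Q]%G n) (U : 'M[k]_n)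
    (modU : mxmodule rG U) m (W : 'M_(m, \rank U)) :
  val_submod (W *m conjugation_sum (submod_repr modU)) =
  val_submod W *m conjugation_sum rG.
Proof.
have vJ p (Z : 'M_(p, \rank U)) x :
    val_submod (Z *m submod_repr modU x) = val_submod Z *m rG x.
  by rewrite val_submodJ ?inE.
have vP p (Z : 'M_(p, \rank U)) :
    val_submod (Z *m pullback_mx pi (submod_repr modU) c) =
    val_submod Z *m pullback_mx pi rG c.
  rewrite !mulmx_sumr linear_sum; apply: eq_bigr => g _.
  by rewrite -!scalemxAr linearZ /= vJ.
rewrite !mulmx_sumr linear_sum; apply: eq_bigr => x _.
by rewrite mulmxA [LHS]vJ mulmxA vP vJ !mulmxA.
Qed.

(** The solutions [x] form the left coset of ['C[y]] through [z^-1]. *)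
Lemma card_conjugators (b y z : Q) :
  b = (y ^ z)%g -> #|[pred x | b == y ^ x^-1]%g| = #|'C[y]%g|.
Proof.
move=> ->; rewrite -(card_lcoset _ z^-1%g); apply: eq_card => x.
rewrite inE mem_lcoset invgK -(inj_eq (conjg_inj x)) conjgKV -conjgM.
apply/eqP/cent1P => [yzx|czx]; first by rewrite /commute [RHS]conjgC yzx.
by rewrite conjgE -czx mulKg.
Qed.

(** Cyclicity of the trace shifts the conjugation by [x] onto [pi g0]. After exchanging sums, each
    [g] counts the [x] that conjugate [pi g] to [pi g0]: a coset of the centralizer, or none by
    [sep]. *)
Lemma mxtrace_conjugation_sum_regular (g0 : G) :
  (forall g, g \in msupp (c : {malg k[G]}) ->
     Defs.conjugate (pi g) (pi g0) -> Defs.conjugate g g0) ->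
  \tr (conjugation_sum (regular_repr k [set: Q]%G) *m
       regular_repr k [set: Q]%G (pi g0)^-1%g)
    = #|Q|%:R * #|'C[pi g0]%g|%:R *
      \sum_(g <- msupp (c : {malg k[G]}) | `[< Defs.conjugate g g0 >])
         (c : {malg k[G]})@_g.
Proof.
move=> sep; rewrite mulmx_suml raddf_sum /=.
transitivity (\sum_(x : Q) #|Q|%:R *
    \sum_(g <- msupp (c : {malg k[G]}) | pi g == (pi g0 ^ x^-1)%g)
      (c : {malg k[G]})@_g).
  apply: eq_bigr => x _; rewrite -mxtrace_pullback_regular.
  rewrite -!mulmxA mxtrace_mulC -!mulmxA -!repr_mxM ?inE //.
  by rewrite -conjVg conjgE invgK.
rewrite -mulr_sumr -mulrA; congr (_ * _).
rewrite (exchange_big_dep xpredT) //= mulr_sumr [RHS]big_mkcond.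
rewrite [LHS]big_seq [RHS]big_seq.
apply: eq_bigr => g gc; rewrite sumr_const; case: asboolP => [[z zP]|ncg].
  rewrite mulr_natl; congr (_ *+ _).
  have pE : pi g = (pi g0 ^ pi z^-1)%g by rewrite -multiplicativeJ zP conjgK.
  exact: card_conjugators pE.
rewrite (@eq_card0 _ _) // => x; rewrite inE; apply/eqP => pg.
by apply: ncg; apply: sep => //; exists x; rewrite pg conjgKV.
Qed.

End ClassAverage.

(** * Part (ii): conjugacy separability *)

Lemma conjugacy_separable_trace_RFD (k : fieldType) (G : groupType) :
  [pchar k] =i pred0 -> GRing.closed_field_axiom k -> conjugacy_separable G ->
  trace_RFD (group_algebra k G).
Proof.
move=> char0 closed_k sepG.
have nat0 n : (0 < n)%N -> n%:R != 0 :> k.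
  by rewrite (proj1 (pcharf0P k) char0) -lt0n.
split.
  (* Residual finiteness follows by separating [g] from [1], whose class is a singleton. *)
  apply: residually_finite_RFD => // g g1.
  have [|Q [pi [surj sep]]] := sepG g 1%g.
    by case=> x /esym/eqP; rewrite conjg_eq1 => /eqP.
  exists Q, pi; split=> // pg; apply: sep.
  by rewrite pg multiplicative1; exact: conjugate_refl.
move=> q; rewrite -[q]cocenter_class_repr; move: (generic_quotient.repr q) => c.
rewrite cocenter_class_eq0 => cspan.
have [g0 sum0] : exists g0,
    \sum_(g <- msupp (c : {malg k[G]}) | `[< Defs.conjugate g g0 >])
    (c : {malg k[G]})@_g != 0.
  apply: contrapT => nsum; move/negP: cspan; apply.
  apply: class_sums_commutator_span => g0.
  by apply/eqP/negPn/negP => sg; apply: nsum; exists g0.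
have [|||Q [pi sep]] := @joint_quotient G (fun Q => @Defs.conjugate Q) _ _ g0
    [seq g <- msupp (c : {malg k[G]}) | ~~ `[< Defs.conjugate g g0 >]].
- by move=> Q1 Q2 a b [x bE]; exists x.1; rewrite bE.
- by move=> Q1 Q2 a b [x bE]; exists x.2; rewrite bE.
- move=> g; rewrite mem_filter => /andP [/asboolPn ng _].
  by have [Q [pi [_ sep]]] := sepG _ _ ng; exists Q, pi.
pose R := regular_repr k [set: Q]%G; pose D := conjugation_sum pi c R.
(* The trace of [D *m R (pi g0)^-1] is [#|Q|] times a centralizer order times the nonzero class sum
   of [g0]. *)
have [l l0 Dl] : exists2 l, l != 0 & eigenvalue D l.
  apply: (nonzero_eigenvalue closed_k (B := R (pi g0)^-1%g)).
    by apply: (centgmxP (conjugation_sum_centg _ _ _)); exact: in_setT.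
  rewrite mxtrace_conjugation_sum_regular.
    by rewrite !mulf_neq0 ?nat0 -?cardsT ?(cardG_gt0 [set: Q]%G) ?cardG_gt0.
  move=> g gc pg; apply: contrapT => ng; apply: (sep g) => //.
  by rewrite mem_filter gc andbT; apply/asboolPn.
have modU : mxmodule R (eigenspace D l).
  apply: kermx_centg_module; apply/centgmxP => x Gx.
  rewrite mulmxBl mulmxBr scalar_mxC; congr (_ - _).
  by apply: (centgmxP (conjugation_sum_centg _ _ _)).
have U0 : (0 < \rank (eigenspace D l))%N by rewrite lt0n mxrank_eq0.
exists (pullback_rep pi (submod_repr modU) U0).
rewrite cocenter_traceE lftrace_pullback.
(* [D] is multiplication by [l] on its eigenspace; taking traces there evaluates the trace of
   [c]. *)
have /(congr1 mxtrace) : conjugation_sum pi c (submod_repr modU) = l%:M.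
  apply: (@val_submod_inj _ _ (eigenspace D l)).
  rewrite -[X in val_submod X]mul1mx conjugation_sum_submod.
  rewrite -[l%:M]scalemx1 linearZ /=; apply/eigenspaceP; exact: val_submodP.
rewrite mxtrace_conjugation_sum mxtrace_scalar => trE.
have : #|Q|%:R * \tr (pullback_mx pi (submod_repr modU) c) != 0.
  by rewrite trE -mulr_natr mulf_neq0 ?nat0.
by rewrite mulf_eq0 negb_or => /andP [].
Qed.

Theorem proposition3p4 (k : fieldType) (char0 : [pchar k] =i pred0)
    (G : groupType) :
  (residually_finite G -> RFD (group_algebra k G)) /\
  (GRing.closed_field_axiom k -> conjugacy_separable G ->
   trace_RFD (group_algebra k G)).
Proof.
split; first exact: residually_finite_RFD.
exact: conjugacy_separable_trace_RFD.
Qed.
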